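(* Let $A$ be an abelian group, and let $\underline a=\{a_k\}_{k\in\mathbb N}\subseteq A$ be a sequence such that the order $t_k:=o(a_k)$ is finite for every $k\in\mathbb N$. Consider the following statements: (i) $\displaystyle\lim_{k\to\infty}\frac{t_k}{\gcd(t_k,\operatorname{lcm}(t_1,\ldots,t_{k-1}))}=\infty$. (ii) For every $l\in\mathbb N$, $$\lim_{m\to\infty}\inf\left\{\max_{1\le i\le l}\frac{t_{k_i}}{\gcd(t_{k_i},\operatorname{lcm}(t_{k_1},\ldots,t_{k_{i-1}},t_{k_{i+1}},\ldots,t_{k_l}))}\;\middle|\;\underline k\in\mathbb N^l_{m<}\right\}=\infty.$$ (iii) For every $l\in\mathbb N$, $$\lim_{m\to\infty}\inf\left\{\max_{1\le i\le l}o(a_{k_i}+A_{\underline k^i})\;\middle|\;\underline k\in\mathbb N^l_{m<}\right\}=\infty,$$ where $A_{\underline k^i}=\langle a_{k_1},\ldots,a_{k_{i-1}},a_{k_{i+1}},\ldots,a_{k_l}\rangle$. (iv) For every $l,n\in\mathbb N$ there exists $m_0\in\mathbb N$ such that $A[n]\cap A(l,m)_{\underline a}=\{0\}$ for every $m\ge m_0$. (v) $\{a_k\}$ is a $T$-sequence in $A$. Then (i) $\Rightarrow$ (ii) $\Rightarrow$ (iii) $\Rightarrow$ (iv) $\Rightarrow$ (v), and if $A$ is almost torsion-free, then (v) $\Rightarrow$ (iv).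
   Context: $\mathbb N=\{1,2,3,\ldots\}$. A sequence $\{a_k\}$ in a group $G$ is a $T$-sequence if there is a Hausdorff group topology $\tau$ on $G$ such that $a_k\to 0$ (the neutral element) in $\tau$. For $l,m\in\mathbb N$: $\mathbb N^l_{m<}=\{\underline k=(k_1,\ldots,k_l)\in\mathbb N^l\mid m\le k_1<\cdots<k_l\}$, and $$A(l,m)_{\underline a}=\{m_1a_{k_1}+\cdots+m_ha_{k_h}\mid m\le k_1<\cdots<k_h,\ m_i\in\mathbb Z\setminus\{0\},\ \textstyle\sum|m_i|\le l\},$$ where the number $h$ of summands varies, and $h=0$ is allowed, the empty sum being $0$. $A[n]=\{a\in A: na=0\}$. $A$ is almost torsion-free if $A[n]$ is finite for every $n\in\mathbb N$. $o(a)$ is the order of $a$; for a subgroup $B\le A$, $o(a+B)$ is the order of the coset $a+B$ in $A/B$. Conventions: the lcm of an empty family is $1$, and the subgroup generated by the empty set is $\{0\}$. *)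

(* Defs.v *)
From HB Require Import structures.
From mathcomp Require Import all_boot all_order all_algebra.
From mathcomp Require Import all_classical all_reals all_analysis.

Set Implicit Arguments.
Unset Strict Implicit.
Unset Printing Implicit Defensive.

Import Order.TTheory GRing.Theory Num.Theory.

Local Open Scope classical_set_scope.
Local Open Scope ring_scope.

(* Natural-number indices start at 1: a sequence is a function [a : nat -> A]
   of which only the values [a k] with [1 <= k] are ever used, and parameters
   ranging over the positive integers carry an explicit [1 <= _]. *)

Section Groups.
Variable A : zmodType.

Definition finite_order (x : A) : Prop :=
  exists n : nat, (1 <= n)%N /\ x *+ n = 0.

(* The library's [infimum 0 S] is the minimum of a nonempty [S : set nat], and
   is 0 when S is empty; so the value 0 encodes an infinite order here and in
   [coset_order] below. *)
Definition order (x : A) : nat :=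
  infimum 0%N [set n : nat | (1 <= n)%N /\ x *+ n = 0].

Definition is_subgroup (B : set A) : Prop :=
  B 0 /\ forall x y, B x -> B y -> B (x - y).

Definition generated (X : set A) : set A := smallest is_subgroup X.

(* Order of the coset x + B in A / B: n (x + B) = B iff n x belongs to B. *)
Definition coset_order (B : set A) (x : A) : nat :=
  infimum 0%N [set n : nat | (1 <= n)%N /\ B (x *+ n)].

Definition torsion (n : nat) : set A := [set x | x *+ n = 0].

Definition almost_torsion_free : Prop :=
  forall n : nat, (1 <= n)%N -> finite_set (torsion n).

(* [tau] ranges over the topologies carried by the very type A. *)
Definition is_group_topology (tau : Topological.axioms_ A) : Prop :=
  let T : topologicalType := Topological.Pack tau in
  continuous ((fun p => (p.1 : A) + (p.2 : A)) : T * T -> T) /\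
  continuous ((fun x => - (x : A)) : T -> T).

Definition T_sequence (a : nat -> A) : Prop :=
  exists tau : Topological.axioms_ A,
    let T : topologicalType := Topological.Pack tau in
    [/\ is_group_topology tau,
        hausdorff_space T &
        (a : nat -> T) @ \oo --> ((0 : A) : T)].

Definition incr_index (l m : nat) : set ('I_l -> nat) :=
  [set k | (forall i, (m <= k i)%N) /\
           (forall i j : 'I_l, (i < j)%N -> (k i < k j)%N)].

Definition A_lm (a : nat -> A) (l m : nat) : set A :=
  [set x | exists (h : nat) (k : 'I_h -> nat) (c : 'I_h -> int),
     [/\ incr_index m k,
         forall i, c i != 0,
         (\sum_(i < h) `|c i| <= l)%N &
         x = \sum_(i < h) a (k i) *~ c i]].

(* All the quotients of orders below are exact divisions in nat. *)

Definition cond_i (a : nat -> A) : Prop :=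
  let t k := order (a k) in
  (fun k => t k %/ gcdn (t k) (\big[lcmn/1%N]_(1 <= j < k) t j))%N
    @ \oo --> \oo.

Definition cond_ii (a : nat -> A) : Prop :=
  let t k := order (a k) in
  forall l : nat, (1 <= l)%N ->
  (fun m => infimum 0%N
     [set (\max_(i < l)
             (t (k i) %/
              gcdn (t (k i)) (\big[lcmn/1]_(j < l | j != i) t (k j))))%N
     | k in @incr_index l m]) @ \oo --> \oo.

Definition cond_iii (a : nat -> A) : Prop :=
  forall l : nat, (1 <= l)%N ->
  (fun m => infimum 0%N
     [set (\max_(i < l)
             coset_order (generated [set a (k j) | j in [set j | j != i]])
                         (a (k i)))%N
     | k in @incr_index l m]) @ \oo --> \oo.

Definition cond_iv (a : nat -> A) : Prop :=
  forall l n : nat, (1 <= l)%N -> (1 <= n)%N ->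
  exists m0 : nat, (1 <= m0)%N /\
    forall m : nat, (m0 <= m)%N -> torsion n `&` A_lm a l m = [set 0].

Definition cond_v (a : nat -> A) : Prop := T_sequence a.

End Groups.

Arguments almost_torsion_free : clear implicits.

(* Main.v *)
(** (i) => (ii): for increasing k_1 < ... < k_l the last quotient already
    dominates, as lcm (t_{k_1}, ..., t_{k_{l-1}}) divides
    lcm (t_1, ..., t_{k_l - 1}).
    (ii) => (iii): if o is the order of a_{k_i} modulo the subgroup generated by
    the others and L is the lcm of their orders, then L o kills a_{k_i}.
    (iii) => (iv): if n x = 0 with x = sum_i c_i a_{k_i}, then n c_i a_{k_i}
    lies in the subgroup generated by the others, so each coset order is at
    most n |c_i| <= n l.
    (iv) => (v) is the construction of Protasov and Zelenyuk: writing T_m for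
    {0} together with the elements a_k, - a_k with k >= m, the sets
    U_s = union_n (T_{s 0} + ... + T_{s (n-1)}), for arbitrary s, form a base
    at 0 of a group topology in which a_k --> 0.  It is Hausdorff: call F
    "stable" if for every g outside F and every l there is an m such that
    g + T_m + ... + T_m (l terms) is disjoint from F.  By (iv) {0} is stable,
    and F + T_m is stable when F is, because only finitely many a_k in T_m lie
    outside a given T_m'.  Hence s can be built one step at a time so that U_s
    avoids a given g <> 0.
    (v) => (iv): A(l, m) is eventually inside any neighbourhood of 0, and
    there are only finitely many nonzero elements of A[n] to avoid. *)

From HB Require Import structures.
From mathcomp Require Import all_boot all_order all_algebra.
From mathcomp Require Import all_classical all_analysis.
From mathcomp Require Import zify.
Require Import Defs.

Set Implicit Arguments.
Unset Strict Implicit.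
Unset Printing Implicit Defensive.

Import Order.TTheory GRing.Theory Num.Theory.

Local Open Scope classical_set_scope.
Local Open Scope ring_scope.

(** * Infima of sets of natural numbers *)

Section NatInfimum.
Implicit Types S : set nat.

(** The least element is an infimum, and infima are unique, so [infimum] can only choose it. *)
Lemma infimum_natP S : S !=set0 ->
  S (infimum 0%N S) /\ forall n, S n -> (infimum 0 S <= n)%N.
Proof.
move=> /[dup] S0 [n0 Sn0].
have exS : exists n, `[< S n >] by exists n0; apply/asboolP.
have [n /asboolP Sn n_min] := ex_minnP exS.
have nS : infimums S n.
  split=> [k Sk|k]; last by apply.
  by apply: n_min; apply/asboolP.
suff -> : infimum 0%N S = n by split=> // k Sk; exact: nS.1.
rewrite /infimum ifF; last by apply/eqP => Se; move: Sn0; rewrite Se.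
apply: (@is_subset1_infimums _ _ S) => //.
exact: xgetPex (ex_intro _ n nS).
Qed.

Lemma infimum_nat_mem S : S !=set0 -> S (infimum 0%N S).
Proof. by move=> /infimum_natP[]. Qed.

Lemma infimum_nat_le S n : S n -> (infimum 0 S <= n)%N.
Proof. by move=> Sn; apply: (infimum_natP _).2 => //; exists n. Qed.

Lemma infimum_nat_ge S N :
  S !=set0 -> (forall n, S n -> N <= n)%N -> (N <= infimum 0 S)%N.
Proof. by move=> S0; apply; exact: infimum_nat_mem. Qed.

End NatInfimum.

(** * Orders of elements and of cosets *)

Section Orders.
Variable A : zmodType.
Implicit Types (x y : A) (B X : set A).

Lemma order_gt0 x : finite_order x -> (0 < order x)%N.
Proof. by move=> /infimum_nat_mem[]. Qed.

Lemma mulrn_order x : finite_order x -> x *+ order x = 0.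
Proof. by move=> /infimum_nat_mem[]. Qed.

Lemma order_dvd x n : finite_order x -> x *+ n = 0 -> (order x %| n)%N.
Proof.
move=> fx; rewrite {1}(divn_eq n (order x)) mulrnDr mulnC mulrnA.
rewrite (mulrn_order fx) mul0rn add0r => xr; rewrite /dvdn.
rewrite eqn0Ngt; apply/negP => r0.
have := @infimum_nat_le [set k | (1 <= k)%N /\ x *+ k = 0] _ (conj r0 xr).
by rewrite -/(order x) leqNgt ltn_pmod // order_gt0.
Qed.

Lemma generated_subgroup X : is_subgroup (generated X).
Proof.
split=> [B [[]] //|x y Xx Xy B /= BP].
by apply: BP.1.2; [exact: Xx | exact: Xy].
Qed.

Lemma sub_generated X : X `<=` generated X.
Proof. exact: sub_gen_smallest. Qed.

Section Subgroup.
Variable B : set A.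
Hypothesis BP : is_subgroup B.

Lemma subgroup0 : B 0. Proof. exact: BP.1. Qed.

Lemma subgroupN x : B x -> B (- x).
Proof. by move=> Bx; rewrite -sub0r; apply: BP.2 => //; exact: subgroup0. Qed.

Lemma subgroupD x y : B x -> B y -> B (x + y).
Proof. by move=> Bx By; rewrite -(opprK y); apply/BP.2/subgroupN. Qed.

Lemma subgroupMn x n : B x -> B (x *+ n).
Proof.
move=> Bx; elim: n => [|n IHn]; first exact: subgroup0.
by rewrite mulrS; apply: subgroupD.
Qed.

Lemma subgroupMz x (z : int) : B x -> B (x *~ z).
Proof.
move=> Bx; case: z => n; first by rewrite -pmulrn; exact: subgroupMn.
by rewrite NegzE mulrNz; apply/subgroupN; rewrite -pmulrn; exact: subgroupMn.
Qed.

Lemma subgroup_sum (I : Type) (r : seq I) (P : pred I) (F : I -> A) :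
  (forall i, P i -> B (F i)) -> B (\sum_(i <- r | P i) F i).
Proof. by apply: big_ind; [exact: subgroup0 | exact: subgroupD]. Qed.

End Subgroup.

Lemma torsion_subgroup n : is_subgroup (@torsion A n).
Proof.
split=> [|x y]; rewrite /torsion /= ?mul0rn // mulrnBl => -> ->.
by rewrite subr0.
Qed.

Lemma coset_orderP B x : is_subgroup B -> finite_order x ->
  (0 < coset_order B x)%N /\ B (x *+ coset_order B x).
Proof.
move=> BP [n [n1 xn]].
apply: (@infimum_nat_mem [set k | (1 <= k)%N /\ B (x *+ k)]).
by exists n; split=> //; rewrite xn; exact: subgroup0.
Qed.

Lemma coset_order_le B x n : (0 < n)%N -> B (x *+ n) ->
  (coset_order B x <= n)%N.
Proof. by move=> n0 Bxn; apply: infimum_nat_le. Qed.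

(** Let t be the order of x and o that of its coset. Then o L kills x, so t divides o L; dividing by
    g = gcd(t, L) leaves t / g coprime to L / g, hence t / g divides o. *)
Lemma coset_order_ge X x L : finite_order x ->
  (forall y, X y -> y *+ L = 0) ->
  (order x %/ gcdn (order x) L <= coset_order (generated X) x)%N.
Proof.
move=> fx XL; have [d0 xo] := coset_orderP (generated_subgroup X) fx.
set o := coset_order _ _ in d0 xo *.
have t0 := order_gt0 fx.
(* The elements killed by L form a subgroup containing X, hence containing [generated X]. *)
have /xo oL : [set B | is_subgroup B /\ X `<=` B] (@torsion A L).
  by split; [exact: torsion_subgroup | exact: XL].
apply: dvdn_leq => //; have: (order x %| o * L)%N.
  by apply: order_dvd => //; rewrite mulrnA.
(* A fresh name for the gcd keeps it intact when [order x] and [L] are rewritten as multiples of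
   it. *)
have [g [g0 tE]] : exists g, (0 < g)%N /\ gcdn (order x) L = g.
  by eexists; split; last reflexivity; rewrite gcdn_gt0 t0.
rewrite tE; have /dvdnP[t' tt'] : (g %| order x)%N by rewrite -tE dvdn_gcdl.
have /dvdnP[L' LL'] : (g %| L)%N by rewrite -tE dvdn_gcdr.
rewrite tt' mulnK // {1}LL' mulnA dvdn_pmul2r // Gauss_dvdl //.
move: tE; rewrite tt' LL' -muln_gcdl => /eqP.
by rewrite -[X in _ == X]mul1n eqn_pmul2r // /coprime.
Qed.

End Orders.

(** * Increasing tuples of indices, and limits in [nat] *)

Lemma incr_index_shift l m : @incr_index l m (fun i => m + i)%N.
Proof. by split=> [i|i j ij]; rewrite ?leq_addr // ltn_add2l. Qed.

Lemma leq_incr_index l m' m : (m <= m')%N ->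
  @incr_index l m' `<=` @incr_index l m.
Proof. by move=> mm' k [mk kk]; split=> // i; exact: leq_trans mm' _. Qed.

Lemma eventually_geP (P : nat -> Prop) :
  (\forall m \near \oo, P m) <-> exists m0, forall m, (m0 <= m)%N -> P m.
Proof. by split=> [[m0 _ Pm]|[m0 Pm]]; exists m0. Qed.

Lemma cvg_nat_ooP (f : nat -> nat) : f @ \oo --> \oo <->
  forall N, exists m0, forall m, (m0 <= m)%N -> (N <= f m)%N.
Proof.
split=> [/cvgnyPge fN N|fN]; first exact/eventually_geP/fN.
by apply/cvgnyPge => N; exact/eventually_geP/fN.
Qed.

(** * The implications (i) => (ii) => (iii) => (iv) *)

Section Implications.
Variables (A : zmodType) (a : nat -> A).
Hypothesis ha : forall k : nat, (1 <= k)%N -> finite_order (a k).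

Lemma cond_i_ii : cond_i a -> cond_ii a.
Proof.
rewrite /cond_i /cond_ii /= => /cvg_nat_ooP ci l l1; apply/cvg_nat_ooP => N.
(* With [m0.+1] all indices are positive, as [ha] and the lcm over 1 <= j require. *)
have [m0 qN] := ci N; exists m0.+1 => m m0m.
(* The tuple m, m + 1, ... shows nonemptiness; the infimum of an empty set would be 0. *)
apply: infimum_nat_ge; first by eexists; exists (fun i => m + i)%N => //;
  exact: incr_index_shift.
move=> _ [k [mk kk] <-]; case: l l1 k mk kk => // l _ k mk kk.
apply: (leq_trans (qN (k ord_max) (leq_trans (ltnW m0m) (mk _)))).
apply: leq_trans (leq_bigmax ord_max) => /=.
have t0 : (0 < order (a (k ord_max)))%N.
  by apply/order_gt0/ha/(leq_trans _ (mk _)); exact: leq_trans m0m.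
(* Enlarging the lcm enlarges the gcd and so lowers the quotient. *)
apply: leq_div2l; first by rewrite gcdn_gt0 t0.
apply: dvdn_leq; first by rewrite gcdn_gt0 t0.
rewrite dvdn_gcd dvdn_gcdl /=; apply: dvdn_trans (dvdn_gcdr _ _) _.
apply/dvdn_biglcmP => j jmax.
have kj : (k j < k ord_max)%N.
  apply: kk; rewrite ltn_neqAle -ltnS ltn_ord andbT.
  by apply: contra jmax => /eqP jl; apply/eqP/val_inj.
rewrite (big_rem (k j)) /= ?dvdn_lcml // mem_index_iota kj andbT.
by apply: leq_trans (mk j); exact: leq_trans m0m.
Qed.

Lemma cond_ii_iii : cond_ii a -> cond_iii a.
Proof.
move=> cii l l1; apply/cvg_nat_ooP => N.
have /cvg_nat_ooP/(_ N)[m0 qN] := cii l l1; exists m0.+1 => m m0m.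
apply: infimum_nat_ge; first by eexists; exists (fun i => m + i)%N => //;
  exact: incr_index_shift.
move=> _ [k kP <-].
have fk i : finite_order (a (k i)).
  by apply/ha/(leq_trans _ (kP.1 i)); exact: leq_trans m0m.
apply: (leq_trans (qN m (ltnW m0m))).
apply: leq_trans; first by apply: infimum_nat_le; exists k; [exact: kP|].
apply/bigmax_leqP => i _; apply: leq_trans (leq_bigmax i).
apply: coset_order_ge => // _ [j /= ji <-].
have /dvdnP[q ->] :
    (order (a (k j)) %| \big[lcmn/1]_(j < l | j != i) order (a (k j)))%N.
  by apply: (@biglcmn_sup _ j).
by rewrite mulnC mulrnA mulrn_order // mul0rn.
Qed.

Lemma A_lm0 l m : A_lm a l m 0.
Proof.
exists 0%N, (fun=> 0%N), (fun=> 0); split; rewrite ?big_ord0 //.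
- by split=> -[].
- by case.
Qed.

Lemma sub_A_lm l m m' : (m <= m')%N -> A_lm a l m' `<=` A_lm a l m.
Proof.
move=> mm' x [h [k [c [kP c0 cl ->]]]]; exists h, k, c; split=> //.
exact: leq_incr_index kP.
Qed.

Lemma cond_iii_iv : cond_iii a -> cond_iv a.
Proof.
move=> ciii l n l1 n1.
(* The number h of summands varies, so (iii) is used for each h separately. Nonzero coefficients
   force h <= l, so the maximum of [M h] over h <= l will serve. *)
have /choice[M MP] h : exists M, forall m, (0 < h)%N -> (M <= m)%N ->
    forall k : 'I_h -> nat, incr_index m k ->
    (n * l < \max_(i < h)
       coset_order (generated [set a (k j) | j in [set j | j != i]])
         (a (k i)))%N.
  have [->|h1] := posnP h; first by exists 0%N.
  have /cvg_nat_ooP/(_ (n * l).+1)[M MP] := ciii h h1.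
  exists M => m _ Mm k kP; apply: (leq_trans (MP _ Mm)).
  by apply: infimum_nat_le; exists k.
exists (\max_(h < l.+1) M h).+1; split=> // m Mm.
apply/seteqP; split=> [x [/= xn [h [k [c [kP c0 cl xE]]]]]|_ ->]; last first.
  by split; [exact: (subgroup0 (torsion_subgroup A n)) | exact: A_lm0].
have hl : (h <= l)%N.
  apply: leq_trans cl; rewrite -[X in (X <= _)%N]card_ord -sum1_card.
  by apply: leq_sum => i _; rewrite absz_gt0.
have [h0|h1] := posnP h.
  by rewrite xE; move: k c {kP c0 cl xE}; rewrite h0 => k c; rewrite big_ord0.
exfalso.
have := MP h m h1 _ k kP; apply/not_implyP; split.
  apply: leq_trans (ltnW Mm).
  exact: (@leq_bigmax _ (fun h : 'I_l.+1 => M h) (Ordinal (hl : (h < l.+1)%N))).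
apply/negP; rewrite -leqNgt; apply/bigmax_leqP => i _.
set B := generated _; have BP : is_subgroup B by exact: generated_subgroup.
have cil : (`|c i| <= l)%N.
  by apply: leq_trans cl; rewrite (bigD1 i) //= leq_addr.
apply: leq_trans (_ : n * `|c i| <= _)%N; last by rewrite leq_mul2l cil orbT.
apply: coset_order_le; first by rewrite muln_gt0 n1 absz_gt0 c0.
have : B (a (k i) *~ c i *+ n).
  have -> : a (k i) *~ c i *+ n =
      - \sum_(j < h | j != i) (a (k j) *~ c j *+ n).
    apply/eqP; rewrite -addr_eq0 -(bigD1 i (P := xpredT)) //= sumrMnl -xE.
    by rewrite xn.
  apply: (subgroupN BP); apply: (subgroup_sum BP) => j ji.
  apply: (subgroupMn BP); apply: (subgroupMz BP).
  by apply: sub_generated; exists j.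
(* A negative coefficient is replaced by its absolute value, as B is closed under negation. *)
rewrite mulnC mulrnA; case: (c i) => q; first by rewrite -pmulrn.
rewrite NegzE mulrNz mulNrn -pmulrn /= => /(subgroupN BP).
by rewrite opprK.
Qed.

End Implications.

(** * The topology of Protasov and Zelenyuk *)

Section ProtasovZelenyuk.
Variables (A : zmodType) (a : nat -> A).
Implicit Types (F : set A) (s : nat -> nat).

Definition tail (m : nat) : set A :=
  [set x | x = 0 \/ exists2 k, (m <= k)%N & x = a k \/ x = - a k].

Definition sumset (F G : set A) : set A := [set x + y | x in F & y in G].

Fixpoint tail_sum s n : set A :=
  if n is n'.+1 then sumset (tail_sum s n') (tail (s n')) else [set 0].

Lemma tail0 m : tail m 0. Proof. by left. Qed.

Lemma tailN m x : tail m x -> tail m (- x).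
Proof.
case=> [->|[k mk [->|->]]]; first by left; rewrite oppr0.
  by right; exists k => //; right.
by right; exists k => //; left; rewrite opprK.
Qed.

Lemma sub_tail m m' : (m <= m')%N -> tail m' `<=` tail m.
Proof.
move=> mm' x [->|[k mk xk]]; first by left.
by right; exists k => //; exact: leq_trans mk.
Qed.

Lemma tail_sumN s n x : tail_sum s n x -> tail_sum s n (- x).
Proof.
elim: n x => [x /= ->|n IHn _ [x xs [y yt <-]]] /=; first by rewrite oppr0.
by exists (- x); [exact: IHn | exists (- y); [exact: tailN | rewrite opprD]].
Qed.

Lemma sub_tail_sum s s' n : (forall i, (s i <= s' i)%N) ->
  tail_sum s' n `<=` tail_sum s n.
Proof.
move=> ss'; elim: n => //= n IHn _ [x xs [y yt <-]].
by exists x; [exact: IHn | exists y => //; exact: sub_tail yt].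
Qed.

Lemma tail_sum_widen s n n' : (n <= n')%N -> tail_sum s n `<=` tail_sum s n'.
Proof.
move=> /subnK <-; elim: (n' - n)%N => //= d IHd x /IHd xs.
by exists x => //; exists 0; [exact: tail0 | rewrite addr0].
Qed.

(** The i-th summands of x and of y go to places 2i and 2i + 1 of [s]. *)
Lemma tail_sumD s s' n x y :
  (forall i, (s i.*2 <= s' i)%N) -> (forall i, (s i.*2.+1 <= s' i)%N) ->
  tail_sum s' n x -> tail_sum s' n y -> tail_sum s n.*2 (x + y).
Proof.
move=> s0 s1; elim: n x y => [x y /= -> ->|n IHn]; first by rewrite addr0.
move=> _ _ [x xs [u ut <-]] [y ys [v vt <-]] /=.
exists (x + y + u); last first.
  by exists v; [exact: sub_tail vt | rewrite addrACA addrA].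
by exists (x + y); [exact: IHn | exists u => //; exact: sub_tail ut].
Qed.

(** Adding a_j or - a_j changes only the coefficient c_j, by 1. The bound N stays free so that the
    induction can push it past a new index j. *)
Lemma tail_sum_coef m n x : tail_sum (fun=> m) n x ->
  exists c : nat -> int, (forall k, c k != 0 -> (m <= k)%N) /\
    exists N0, forall N, (N0 <= N)%N ->
      (\sum_(k < N) `|c k| <= n)%N /\ x = \sum_(k < N) a k *~ c k.
Proof.
elim: n x => [x /= ->|n IHn _ [x /IHn [c [cm [N0 cP]]] [y yt <-]]].
  exists (fun=> 0); split=> //.
  by exists 0%N => N _; split; rewrite big1.
have [j [e [mj e1 ->]]] : exists j (e : int),
    [/\ (m <= j)%N, (`|e| <= 1)%N & y = a j *~ e].
  case: yt => [->|[k mk [->|->]]].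
  - by exists m, 0.
  - by exists k, 1.
  - by exists k, (-1); rewrite mulrN1z.
exists (fun k => if k == j then c k + e else c k); split.
  by move=> k; have [->|_] := eqVneq k j; last exact: cm.
exists (maxn N0 j.+1) => N; rewrite geq_max => /andP[N0N jN].
have [cn ->] := cP N N0N; pose j' := Ordinal jN.
have rest (k : 'I_N) : k != j' -> (k == j :> nat) = false.
  by move=> kj; apply/negbTE; apply: contra kj => /eqP kj; apply/eqP/val_inj.
split.
  move: cn; rewrite !(bigD1 j' (P := xpredT)) //= eqxx.
  rewrite [X in (_ + X <= n.+1)%N](eq_bigr (fun k : 'I_N => `|c k|%N)).
    by lia.
  by move=> k /rest ->.
rewrite !(bigD1 j' (P := xpredT)) //= eqxx mulrzDr addrAC.
by congr (_ + _); apply: eq_bigr => k /rest ->.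
Qed.

Lemma tail_sum_A_lm m l : tail_sum (fun=> m) l `<=` A_lm a l m.
Proof.
move=> x /tail_sum_coef[c [cm [N /(_ N (leqnn N)) [cl ->]]]].
(* The support of c in increasing order: repeated indices are already merged and zero coefficients
   are dropped here. *)
pose r := [seq k <- iota 0 N | c k != 0].
have r_sorted : sorted ltn r.
  by apply: sorted_filter; [exact: ltn_trans | exact: iota_ltn_sorted].
exists (size r), (fun i => nth 0%N r i), (fun i => c (nth 0%N r i)).
have cr (i : 'I_(size r)) : c (nth 0%N r i) != 0.
  by have := mem_nth 0%N (ltn_ord i); rewrite mem_filter => /andP[].
(* Stated for any R because it serves both the sum of the |c_k| in [nat] and the sum in A. *)
have rE (R : nmodType) (G : nat -> R) : (forall k, c k = 0 -> G k = 0) ->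
    \sum_(i < size r) G (nth 0%N r i) = \sum_(k < N) G k.
  move=> G0; rewrite -(big_mkord xpredT (fun i => G (nth 0%N r i))).
  rewrite -(big_nth 0%N xpredT G) big_filter big_mkcond /=.
  rewrite -[in RHS](big_mkord xpredT G) /index_iota subn0.
  by apply: eq_bigr => k _; case: eqP => //= /G0 ->.
split=> //.
- split=> [i|i j ij]; first exact: cm.
  by apply: (sorted_ltn_nth ltn_trans) => //; rewrite inE.
- apply: leq_trans cl; have := rE nat (fun k => `|c k|%N).
  by rewrite /= => -> // k ->.
- by rewrite (rE A (fun k => a k *~ c k)) // => k ->.
Qed.

Lemma tail_sum_const_add m n n' x y : tail_sum (fun=> m) n x ->
  tail_sum (fun=> m) n' y -> tail_sum (fun=> m) (n + n') (x + y).
Proof.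
move=> xn; elim: n' y => [y /= ->|n' IHn' _ [y yn [z zm <-]]].
  by rewrite addn0 addr0.
by rewrite addnS addrA; exists (x + y); [exact: IHn' | exists z].
Qed.

Lemma tail_sum_mulz m x (c : int) :
  tail m x -> tail_sum (fun=> m) `|c| (x *~ c).
Proof.
have pos n y : tail m y -> tail_sum (fun=> m) n (y *+ n).
  move=> ym; elim: n => //= n IHn.
  by exists (y *+ n) => //; exists y => //; rewrite mulrSr.
move=> xm; case: c => n; first by rewrite -pmulrn; exact: pos.
by rewrite NegzE mulrNz -mulNrz -pmulrn abszN; exact/pos/tailN.
Qed.

Lemma A_lm_tail_sum m l : A_lm a l m `<=` tail_sum (fun=> m) l.
Proof.
move=> _ [h [k [c [kP _ cl ->]]]]; apply: tail_sum_widen cl _ _.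
elim/big_ind2: _ => // [x n y n'|i _]; first exact: tail_sum_const_add.
by apply: tail_sum_mulz; right; exists (k i); [exact: kP.1 | left].
Qed.

Definition stable F : Prop := forall g, ~ F g -> forall l, exists m,
  forall y, tail_sum (fun=> m) l y -> ~ F (g + y).

(** Suppose g + y = f + e with f in F and e in T_m. If e lies in T_m', then y - e is a sum of l + 1
    terms and stability at g applies. The other e are among finitely many a_k, - a_k with k < m',
    and stability is used at each g - e. *)
Lemma stable_sumset F m : stable F -> stable (sumset F (tail m)).
Proof.
move=> Fst g FTg l.
have Fg e : tail m e -> ~ F (g - e).
  by move=> et Fge; apply: FTg; exists (g - e) => //; exists e; rewrite ?subrK.
have [m' m'P] : exists m', forall y, tail_sum (fun=> m') l.+1 y -> ~ F (g + y).
  by apply: Fst; rewrite -[g]subr0; apply/Fg/tail0.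
have /choice[M MP] e : exists M, tail m e ->
    forall y, tail_sum (fun=> M) l y -> ~ F (g - e + y).
  have [et|?] := pselect (tail m e); last by exists 0%N.
  by have [M MP] := Fst _ (Fg _ et) l; exists M.
pose M' := \max_(k < m') maxn (M (a k)) (M (- a k)).
have MM' k : (k < m')%N -> (M (a k) <= M' /\ M (- a k) <= M')%N.
  move=> km'; apply/andP; rewrite -geq_max.
  exact: (@leq_bigmax _ (fun k : 'I_m' => maxn (M (a k)) (M (- a k)))
    (Ordinal km')).
exists (maxn (maxn m' (M 0%R)) M') => y yt [f Ff [e et fe]].
have {fe} fE : f = g - e + y.
  by apply: (addIr e); rewrite fe addrAC subrK.
(* This excludes every e whose threshold entered the maximum: 0 and the a_k, - a_k with k < m'. *)
have far : ~ (M e <= maxn (maxn m' (M 0%R)) M')%N.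
  move=> Me; apply: (MP e et y); last by rewrite -fE.
  by apply: (sub_tail_sum _ yt).
case: (et) => [e0|[k mk ek]].
  by apply: far; rewrite e0 !leq_max leqnn orbT.
have [km'|m'k] := ltnP k m'.
  by apply: far; rewrite leq_max; apply/orP; right; case: ek => ->;
    have [] := MM' k km'.
apply: (m'P (y - e)); last by rewrite (addrC y) addrA -fE.
exists y; first by apply: sub_tail_sum yt => _; rewrite !leq_max leqnn.
by exists (- e) => //; apply: tailN; right; exists k.
Qed.

(** This is stability with l = 1: g = x + y gives x = g + (- y), and [tail] is symmetric. *)
Lemma stable_avoid g F : stable F -> ~ F g ->
  exists m, ~ sumset F (tail m) g.
Proof.
move=> Fst Fg; have [m mP] := Fst g Fg 1%N.
exists m => -[x Fx [y yt xyg]]; apply: (mP (- y)); last by rewrite -xyg addrK.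
by exists 0 => //; exists (- y); [exact: tailN | rewrite add0r].
Qed.

Lemma tail_sum_avoid g : stable [set 0] -> g != 0 ->
  exists s, forall n, ~ tail_sum s n g.
Proof.
move=> st0 /eqP g0.
have /choice[mf mfP] F : exists m, stable F -> ~ F g ->
    ~ sumset F (tail m) g.
  have [[Fst Fg]|nF] := pselect (stable F /\ ~ F g).
    by have [m mP] := stable_avoid Fst Fg; exists m.
  by exists 0%N => Fst Fg; case: nF.
(* The next index depends only on the set built so far, so the sets are plain iterates and [s] is
   read off from them. *)
pose Fs n := iter n (fun F => sumset F (tail (mf F))) [set 0].
have FsE n : tail_sum (fun i => mf (Fs i)) n = Fs n.
  by elim: n => //= n ->.
have FsP n : stable (Fs n) /\ ~ Fs n g.
  elim: n => //= n [Fst Fg]; split; first exact: stable_sumset.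
  exact: mfP.
by exists (fun i => mf (Fs i)) => n; rewrite FsE; exact: (FsP n).2.
Qed.

Definition tail_space : Type := A.

HB.instance Definition _ := Choice.on tail_space.

Definition tail_nbhs (p : tail_space) : set_system tail_space :=
  [set V | exists s, forall n y, tail_sum s n y -> V ((p : A) + y)].

HB.instance Definition _ := hasNbhs.Build tail_space tail_nbhs.

Lemma tail_nbhs_filter (p : tail_space) : ProperFilter (nbhs p).
Proof.
apply: Build_ProperFilter_ex => [V [s sV]|].
  by exists ((p : A) + 0); exact: (sV 0%N).
split=> [|V W [s sV] [s' sW]|V W VW [s sV]].
- by exists (fun=> 0%N).
- exists (fun i => maxn (s i) (s' i)) => n y ys; split.
    by apply: (sV n); apply: sub_tail_sum ys => i; exact: leq_maxl.
  by apply: (sW n); apply: sub_tail_sum ys => i; exact: leq_maxr.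
- by exists s => n y /sV /VW.
Qed.

Lemma tail_nbhs_singleton (p : tail_space) (V : set tail_space) :
  nbhs p V -> V p.
Proof. by case=> s sV; have := sV 0%N 0 erefl; rewrite addr0. Qed.

(** Chosen so that U_(halve s) + U_(halve s) lies in U_s. *)
Definition halve s i := maxn (s i.*2) (s i.*2.+1).

Lemma halve_tail_sumD s n n' x y : tail_sum (halve s) n x ->
  tail_sum (halve s) n' y -> tail_sum s (maxn n n').*2 (x + y).
Proof.
move=> xs ys; apply: (@tail_sumD _ (halve s)).
- by move=> i; exact: leq_maxl.
- by move=> i; exact: leq_maxr.
- by apply: tail_sum_widen xs; exact: leq_maxl.
- by apply: tail_sum_widen ys; exact: leq_maxr.
Qed.

Lemma tail_nbhs_nbhs (p : tail_space) (V : set tail_space) :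
  nbhs p V -> nbhs p (nbhs^~ V).
Proof.
move=> [s sV]; exists (halve s) => n y ys; exists (halve s) => n' y' ys'.
by rewrite -addrA; apply: sV; exact: halve_tail_sumD ys ys'.
Qed.

HB.instance Definition _ := Nbhs_isNbhsTopological.Build tail_space
  tail_nbhs_filter tail_nbhs_singleton tail_nbhs_nbhs.

Lemma tail_space_group : is_group_topology (Topological.on tail_space).
Proof.
split=> [[x y] V [s sV]|x V [s sV]].
  exists ([set (x : A) + u | u in \bigcup_n tail_sum (halve s) n],
          [set (y : A) + u | u in \bigcup_n tail_sum (halve s) n]).
    by split; exists (halve s) => n u us; exists u => //; exists n.
  move=> [_ _] [/= [u [n _ us] <-] [v [n' _ vs] <-]].
  by rewrite addrACA; apply: sV; exact: halve_tail_sumD us vs.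
exists s => n y /tail_sumN /sV.
by rewrite /= -opprD.
Qed.

(** If p + U_(halve s) meets q + U_(halve s), then p - q lies in U_s by symmetry; [s] is chosen to
    prevent this. *)
Lemma tail_space_hausdorff : stable [set 0] -> hausdorff_space tail_space.
Proof.
move=> st0 p q pq; apply/eqP/negPn/negP => npq.
have [s sP] : exists s, forall n, ~ tail_sum s n ((p : A) - q).
  by apply: tail_sum_avoid => //; rewrite subr_eq0.
pose U (x : A) := [set x + u | u in \bigcup_n tail_sum (halve s) n].
have UP (x : tail_space) : nbhs x (U x).
  by exists (halve s) => n u us; exists u => //; exists n.
have [_ [[u [n _ us] <-] [v [n' _ vs] vE]]] := pq _ _ (UP p) (UP q).
apply: (sP (maxn n' n).*2).
have subE (x y z w : A) : y + w = x + z -> x - y = w - z.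
  by move=> xyzw; apply/eqP; rewrite subr_eq addrAC (addrC w) xyzw addrK.
rewrite (subE _ _ _ _ vE).
by apply: halve_tail_sumD vs _; exact: tail_sumN.
Qed.

Lemma tail_space_cvg : (a : nat -> tail_space) @ \oo --> ((0 : A) : tail_space).
Proof.
move=> V [s sV]; apply/eventually_geP; exists (s 0%N) => k sk.
rewrite /= -[a k](add0r (a k : A)); apply: (sV 1%N); exists 0 => //.
by exists (a k); [right; exists k => //; left | rewrite add0r].
Qed.

Lemma stable_T_sequence : stable [set 0] -> T_sequence a.
Proof.
move=> st0; exists (Topological.on tail_space); split.
- exact: tail_space_group.
- exact: tail_space_hausdorff.
- exact: tail_space_cvg.
Qed.

End ProtasovZelenyuk.

(** * Stability of {0} from (iv), and (v) => (iv) *)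

Section TSequence.
Variables (A : zmodType) (a : nat -> A).

Lemma cond_iv_stable : (forall k : nat, (1 <= k)%N -> finite_order (a k)) ->
  cond_iv a -> stable a [set 0].
Proof.
move=> ha civ g g0 l.
have [[n [n1 gn]]|ng] := pselect (finite_order g).
  (* Stability allows l = 0 while (iv) needs a positive length, hence [l.+1]. *)
  have [m0 [_ m0P]] := civ l.+1 n isT n1.
  exists m0 => y yl gy; apply: g0.
  have ->: g = - y by apply/eqP; rewrite -addr_eq0; apply/eqP.
  have: (torsion n `&` A_lm a l.+1 m0) (- y).
    split; first by rewrite /torsion /= mulNrn; apply/eqP; move/eqP: gy;
      rewrite addrC addr_eq0 => /eqP ->; rewrite mulNrn gn !oppr0.
    by apply: tail_sum_A_lm; apply: tail_sum_widen (leqnSn l) _ _;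
      exact: tail_sumN.
  by rewrite m0P.
(* A g of infinite order is never such a sum: with indices from 1 on, the product of the orders of
   the a_k involved kills the sum. *)
exists 1%N => y yl gy; apply: ng.
have -> : g = - y by apply/eqP; rewrite -addr_eq0; apply/eqP.
have /tail_sum_A_lm[h [k [c [kP _ _ ->]]]] := tail_sumN yl.
pose N := (\prod_(i < h) order (a (k i)))%N.
exists N; split.
  by apply/prodn_gt0 => i; apply/order_gt0/ha/kP.1.
apply: (subgroup_sum (torsion_subgroup A N)) => i _.
apply: subgroupMz; first exact: torsion_subgroup.
rewrite /torsion /= /N (bigD1 i) //= mulrnA mulrn_order ?mul0rn //.
exact/ha/kP.1.
Qed.

(** Passing to l-fold sums of T_m leaves an induction on l by continuity of addition at (0, 0);
    continuity of negation handles the - a_k. *)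
Lemma T_sequence_A_lm_nbhs (tau : Topological.axioms_ A)
    (T := Topological.Pack tau : topologicalType) (U : set A) l :
  is_group_topology tau -> (a : nat -> T) @ \oo --> ((0 : A) : T) ->
  nbhs ((0 : A) : T) U -> exists m, A_lm a l m `<=` U.
Proof.
move=> [addC oppC] a0 U0.
have tailU (V : set A) : nbhs ((0 : A) : T) V -> exists m, tail a m `<=` V.
  move=> V0; have NV0 : nbhs ((0 : A) : T) [set x : A | V (- x)].
    by apply: oppC; rewrite oppr0.
  have [m _ mP] := a0 _ (filterI V0 NV0).
  exists m => x [->|[k /mP[/= Vk NVk] [->|->]]] //.
  exact: (@nbhs_singleton T).
suff [m mP] : exists m, tail_sum a (fun=> m) l `<=` U.
  by exists m => x /A_lm_tail_sum /mP.
elim: l U U0 => [|l IHl] U U0.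
  by exists 0%N => _ ->; exact: (@nbhs_singleton T).
have : nbhs (((0 : A) : T), ((0 : A) : T))
    [set z : T * T | U ((z.1 : A) + (z.2 : A))].
  by apply: addC; rewrite /= addr0.
case=> -[V W] /= [V0 W0] VWU.
have [m mV] := IHl _ V0; have [m' mW] := tailU _ W0.
exists (maxn m m') => _ [x xm [y ym <-]]; apply: (VWU (x, y)); split => /=.
  by apply/mV/(sub_tail_sum _ xm) => _; exact: leq_maxl.
by apply/mW/(sub_tail _ ym); exact: leq_maxr.
Qed.

Lemma cond_v_iv : almost_torsion_free A -> cond_v a -> cond_iv a.
Proof.
move=> atf [tau [gtau hT a0]] l n l1 n1.
pose T := Topological.Pack tau : topologicalType.
have /choice[M MP] g : exists M, g != 0 ->
    forall m, (M <= m)%N -> ~ A_lm a l m g.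
  have [->|g0] := eqVneq g 0; first by exists 0%N.
  (* Each nonzero g gets its own threshold, from an open set around 0 that misses g. *)
  have [U [oU U0 Ug]] : exists U : set T,
      [/\ open U, U ((0 : A) : T) & ~ U g].
    have Tg : ((0 : A) : T) != (g : T).
      by apply/eqP => zg; move: g0; rewrite -[g]zg eqxx.
    have [U [oU /set_mem U0 /set_mem Ug]] := hausdorff_accessible hT Tg.
    by exists U.
  have nU := open_nbhs_nbhs (conj oU U0).
  have [m mU] := @T_sequence_A_lm_nbhs tau _ l gtau a0 nU.
  by exists m => _ m' mm' /(sub_A_lm mm') /mU.
have /finite_seqP[r rE] := atf n n1.
(* The maximum exists because A[n] is finite; the successor makes the bound positive. *)
exists (\max_(g <- r) M g).+1; split=> // m Mm.
apply/seteqP; split=> [x [xn xA]|_ ->]; last first.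
  by split; [exact: (subgroup0 (torsion_subgroup A n)) | exact: A_lm0].
apply: contrapT => /eqP x0; apply: (MP x x0 m _ xA).
apply: leq_trans (ltnW Mm); apply: leq_bigmax_seq => //.
by move: xn; rewrite rE.
Qed.

End TSequence.

Theorem theorem2p2 (A : zmodType) (a : nat -> A)
    (ha : forall k : nat, (1 <= k)%N -> finite_order (a k)) :
  (cond_i a -> cond_ii a) /\
  (cond_ii a -> cond_iii a) /\
  (cond_iii a -> cond_iv a) /\
  (cond_iv a -> cond_v a) /\
  (almost_torsion_free A -> cond_v a -> cond_iv a).
Proof.
split; first exact: cond_i_ii.
split; first exact: cond_ii_iii.
split; first exact: cond_iii_iv.
split; last exact: cond_v_iv.
by move=> civ; exact/stable_T_sequence/cond_iv_stable.
Qed.
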